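(* Let $I:[0,1]^2\to[0,1]$ be a fuzzy implication whose range satisfies $\mathrm{Ran}(I)\neq[0,1]$. If $I$ is a $(\mathcal{GO},N)$-implication, then $I$ is not a $(G,N)$-implication.
   Context: A fuzzy negation is a map $N:[0,1]\to[0,1]$ with $N(0)=1$, $N(1)=0$ and $N(x)\le N(y)$ whenever $y\le x$. A bivariate general overlap function is a function $\mathcal{GO}:[0,1]^2\to[0,1]$ such that for all $x,y\in[0,1]$: (1) $\mathcal{GO}(x,y)=\mathcal{GO}(y,x)$; (2) if $xy=0$ then $\mathcal{GO}(x,y)=0$; (3) if $xy=1$ then $\mathcal{GO}(x,y)=1$; (4) $\mathcal{GO}$ is increasing (in the non-strict sense) in each variable; (5) $\mathcal{GO}$ is continuous. A grouping function is a function $G:[0,1]^2\to[0,1]$ that is commutative, continuous, increasing (in the non-strict sense) in each variable, and satisfies $G(x,y)=0$ if and only if $x=y=0$, and $G(x,y)=1$ if and only if $x=1$ or $y=1$. A fuzzy implication is a function $I:[0,1]^2\to[0,1]$ such that for all $x,y,z\in[0,1]$: $x\le z$ implies $I(x,y)\ge I(z,y)$; $y\le z$ implies $I(x,y)\le I(x,z)$; $I(0,y)=1$; $I(x,1)=1$; $I(1,0)=0$. $I$ is a $(\mathcal{GO},N)$-implication if there exist a bivariate general overlap function $\mathcal{GO}$ and a fuzzy negation $N$ with $I(x,y)=N(\mathcal{GO}(x,N(y)))$ for all $x,y\in[0,1]$. $I$ is a $(G,N)$-implication if there exist a grouping function $G$ and a fuzzy negation $N$ with $I(x,y)=G(N(x),y)$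 for all $x,y\in[0,1]$. *)

(* Defs.v *)
From HB Require Import structures.
From mathcomp Require Import all_boot all_order all_algebra.
From mathcomp Require Import all_classical all_reals all_analysis.

Set Implicit Arguments.
Unset Strict Implicit.
Unset Printing Implicit Defensive.

Import Order.TTheory GRing.Theory Num.Theory.
Import numFieldNormedType.Exports.

Local Open Scope classical_set_scope.
Local Open Scope ring_scope.

(* A map from [0,1] (resp. [0,1]^2) to [0,1] is encoded as a function on R
   (resp. R * R) about which something is said only on [0,1] (resp. [0,1]^2):
   [set_fun] states that it maps the former into the latter, continuity is
   continuity for the subspace topology, and every pointwise condition or
   equation is restricted to arguments in [0,1]. *)

Definition unit_itv {R : realType} : set R := `[0, 1].

Definition unit_square {R : realType} : set (R * R) :=
  unit_itv `*` unit_itv.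

Record fuzzy_negation (R : realType) (N : R -> R) : Prop := FuzzyNegation {
  fneg_fun : set_fun unit_itv unit_itv N;
  fneg0 : N 0 = 1;
  fneg1 : N 1 = 0;
  fneg_antitone : forall x y : R, unit_itv x -> unit_itv y ->
    y <= x -> N x <= N y
}.

Record general_overlap (R : realType) (GO : R * R -> R) : Prop :=
  GeneralOverlap {
  goverlap_fun : set_fun unit_square unit_itv GO;
  goverlapC : forall x y : R, unit_itv x -> unit_itv y ->
    GO (x, y) = GO (y, x);
  goverlap0 : forall x y : R, unit_itv x -> unit_itv y ->
    x * y = 0 -> GO (x, y) = 0;
  goverlap1 : forall x y : R, unit_itv x -> unit_itv y ->
    x * y = 1 -> GO (x, y) = 1;
  goverlap_monol : forall x y z : R,
    unit_itv x -> unit_itv y -> unit_itv z ->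
    x <= z -> GO (x, y) <= GO (z, y);
  goverlap_monor : forall x y z : R,
    unit_itv x -> unit_itv y -> unit_itv z ->
    y <= z -> GO (x, y) <= GO (x, z);
  goverlap_continuous : {within unit_square, continuous GO}
}.

Record grouping (R : realType) (G : R * R -> R) : Prop := Grouping {
  grouping_fun : set_fun unit_square unit_itv G;
  groupingC : forall x y : R, unit_itv x -> unit_itv y ->
    G (x, y) = G (y, x);
  grouping_continuous : {within unit_square, continuous G};
  grouping_monol : forall x y z : R,
    unit_itv x -> unit_itv y -> unit_itv z ->
    x <= z -> G (x, y) <= G (z, y);
  grouping_monor : forall x y z : R,
    unit_itv x -> unit_itv y -> unit_itv z ->
    y <= z -> G (x, y) <= G (x, z);
  grouping_eq0 : forall x y : R, unit_itv x -> unit_itv y ->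
    G (x, y) = 0 <-> x = 0 /\ y = 0;
  grouping_eq1 : forall x y : R, unit_itv x -> unit_itv y ->
    G (x, y) = 1 <-> x = 1 \/ y = 1
}.

Record fuzzy_implication (R : realType) (I : R * R -> R) : Prop :=
  FuzzyImplication {
  fimpl_fun : set_fun unit_square unit_itv I;
  fimpl_antil : forall x y z : R,
    unit_itv x -> unit_itv y -> unit_itv z ->
    x <= z -> I (z, y) <= I (x, y);
  fimpl_monor : forall x y z : R,
    unit_itv x -> unit_itv y -> unit_itv z ->
    y <= z -> I (x, y) <= I (x, z);
  fimpl0y : forall y : R, unit_itv y -> I (0, y) = 1;
  fimplx1 : forall x : R, unit_itv x -> I (x, 1) = 1;
  fimpl10 : I (1, 0) = 0
}.

Definition GON_implication (R : realType) (I : R * R -> R) : Prop :=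
  exists (GO : R * R -> R) (N : R -> R),
    [/\ general_overlap GO, fuzzy_negation N &
        forall x y : R, unit_itv x -> unit_itv y ->
          I (x, y) = N (GO (x, N y))].

Definition GN_implication (R : realType) (I : R * R -> R) : Prop :=
  exists (G : R * R -> R) (N : R -> R),
    [/\ grouping G, fuzzy_negation N &
        forall x y : R, unit_itv x -> unit_itv y ->
          I (x, y) = G (N x, y)].

(* Main.v *)
Require Import Defs.
From mathcomp Require Import all_boot all_order all_algebra.
From mathcomp Require Import all_classical all_reals all_analysis.

Import Order.TTheory GRing.Theory Num.Theory.
Import numFieldNormedType.Exports.

Local Open Scope classical_set_scope.
Local Open Scope ring_scope.

(** Every implication [I (x, y) = G (N x, y)] built from a grouping function
    takes all values in [0,1]. Indeed [N 1 = 0], so on the edge [x = 1] it is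
    the section [G (0, y)] of [G]; this section is continuous
    ([within_continuous_section]), equals 0 at [y = 0] and 1 at [y = 1], and
    hence takes every intermediate value ([grouping_section0_surj]). An
    implication whose range is not [0,1] is therefore never of this form. *)

Lemma within_continuous_section (T U V : topologicalType) (A : set T)
    (B : set U) (f : T * U -> V) (x : T) :
  A x -> {within A `*` B, continuous f} ->
  {within B, continuous (fun y => f (x, y))}.
Proof.
move=> Ax /subspace_continuousP fcont; apply/subspace_continuousP => y By.
have pair_cvg : (x, z) @[z --> y] --> (x, y).
  by apply: cvg_pair; [exact: cvg_cst | exact: cvg_id].
move=> S /(fcont (x, y) (conj Ax By)) /pair_cvg nearS.
by apply: (filterS _ (nearS : nbhs y _)) => z ABS Bz; exact: ABS.
Qed.

Lemma unit_itv0 (R : realType) : (@unit_itv R) 0.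
Proof. by rewrite /unit_itv /= in_itv /= lexx ler01. Qed.

Lemma unit_itv1 (R : realType) : (@unit_itv R) 1.
Proof. by rewrite /unit_itv /= in_itv /= lexx ler01. Qed.

Lemma grouping_section0_surj (R : realType) (G : R * R -> R) (c : R) :
  grouping G -> unit_itv c -> exists2 y, unit_itv y & G (0, y) = c.
Proof.
move=> hG; rewrite {1}/unit_itv /= in_itv /= => c01.
have [I0 I1] := (unit_itv0 R, unit_itv1 R).
have G00 : G (0, 0) = 0 by apply/(grouping_eq0 hG I0 I0).
have G01 : G (0, 1) = 1 by apply/(grouping_eq1 hG I0 I1); right.
have Gcont : {within `[0, 1], continuous (fun y => G (0, y))}.
  exact: within_continuous_section I0 (grouping_continuous hG).
have [|y y01 Gy] := IVT (v := c) ler01 Gcont; last by exists y.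
by rewrite G00 G01 min_l ?max_r ?ler01.
Qed.

Lemma GN_implication_range (R : realType) (I : R * R -> R) :
  GN_implication I -> unit_itv `<=` I @` unit_square.
Proof.
move=> [G [N [hG hN IE]]] c /(grouping_section0_surj _ G _ hG) [y y01 Gy].
exists (1, y); first by split => //; exact: unit_itv1.
by rewrite IE ?(fneg1 hN) //; exact: unit_itv1.
Qed.

Theorem proposition22 (R : realType) (I : R * R -> R)
    (hI : fuzzy_implication I)
    (hran : I @` unit_square <> unit_itv)
    (hGON : GON_implication I) :
  ~ GN_implication I.
Proof.
move=> hGN; apply: hran; apply/seteqP; split; last exact: GN_implication_range.
by move=> _ [p p01 <-]; exact: (fimpl_fun hI).
Qed.
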